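(* Let $G=\theta_{d_1,\dots,d_\ell}$ be a generalized theta graph with $\ell\ge1$ paths and $d_i\ge3$ for all $i$. Then Broadcast is solvable on $G$ with $k$ ignorant agents if and only if $k\ge \ell$.
   Context: Generalized theta graph: $\theta_{d_1,\dots,d_\ell}$ consists of two distinct fixed nodes $N,S$ (the poles) joined by $\ell$ internally vertex-disjoint paths, the $i$-th of which has exactly $d_i$ internal nodes. Broadcast model: a connected base graph $G=(V,E)$ with $n$ nodes. There is one source agent holding a message $\mathcal M$ and $k\ge1$ ignorant agents (agents not holding $\mathcal M$); initially all agents occupy pairwise distinct nodes, the initial placement being chosen by the adversary. Time proceeds in synchronous rounds; in each round: (1) the adversary removes a (possibly empty) set $E'\subseteq E$ of edges such that $(V,E\setminus E')$ is connected; (2) each agent (agents have unique IDs, local memory, and see the entire current graph, the positions of all agents and which agents hold $\mathcal M$) chooses either to stay or to traverse an edge of $E\setminus E'$ incident to its current node; (3) agents move. Whenever an ignorant agent is at the same node as an agent holding $\mathcal M$, it receives $\mathcal M$ and becomes a source agent. The adversary is adaptive and knows the agents' strategy. Broadcast is solvable on $G$ with $k$ ignorant agents if the agents have a strategy such that, for every initial placement and every adversary behaviour, after finitely many rounds all agents hold $\mathcal M$; otherwise the adversary is said to have a winning strategy. *)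

(* Defs.v *)
From HB Require Import structures.
From mathcomp Require Import all_boot.
Set Implicit Arguments. Unset Strict Implicit. Unset Printing Implicit Defensive.

(* Agents are indexed by 'I_n (n = k+1: one source and k ignorant agents). *)
(* A configuration: positions of all agents and the set of agents holding M. *)
Definition config (V : finType) (n : nat) := ({ffun 'I_n -> V} * {set 'I_n})%type.

(* History of past rounds: for each past round, the configuration at its start
   and the graph (E \ E') present in that round. *)
Definition history (V : finType) (n : nat) := seq (config V n * rel V).

Definition adversary (V : finType) (n : nat) := history V n -> config V n -> rel V.

(* The (joint, deterministic) strategy of the agents: since every agent sees the
   whole graph, all positions and informed status, has unbounded memory and
   knows all IDs, the agents' behaviour is a function of the full history, the
   current configuration and the current graph; it outputs new positions. *)
Definition strategy (V : finType) (n : nat) :=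
  history V n -> config V n -> rel V -> {ffun 'I_n -> V}.

Definition admissible_subgraph (V : finType) (adj g : rel V) : Prop :=
  [/\ (forall x y, g x y -> adj x y), (forall x y, g x y = g y x)
    & (forall x y, connect g x y)].

Definition valid_adversary (V : finType) (n : nat) (adj : rel V)
  (alpha : adversary V n) : Prop :=
  forall h c, admissible_subgraph adj (alpha h c).

Definition valid_strategy (V : finType) (n : nat) (adj : rel V)
  (sigma : strategy V n) : Prop :=
  forall h c g, admissible_subgraph adj g ->
    forall a : 'I_n, sigma h c g a = c.1 a \/ g (c.1 a) (sigma h c g a).

Definition update_informed (V : finType) (n : nat) (p : {ffun 'I_n -> V})
  (inf : {set 'I_n}) : {set 'I_n} :=
  inf :|: [set a | [exists b in inf, p b == p a]].

Definition step (V : finType) (n : nat) (sigma : strategy V n)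
  (alpha : adversary V n) (s : history V n * config V n) :
  history V n * config V n :=
  let: (h, c) := s in
  let g := alpha h c in
  let p' := sigma h c g in
  (rcons h (c, g), (p', update_informed p' c.2)).

Definition run (V : finType) (n : nat) (sigma : strategy V n)
  (alpha : adversary V n) (s0 : history V n * config V n) (t : nat) :=
  iter t (step sigma alpha) s0.

Definition broadcast_solvable (V : finType) (adj : rel V) (k : nat) : Prop :=
  exists sigma : strategy V k.+1,
    valid_strategy adj sigma /\
    forall (pos0 : {ffun 'I_k.+1 -> V}) (src : 'I_k.+1) (alpha : adversary V k.+1),
      injective pos0 -> valid_adversary adj alpha ->
      exists t, (run sigma alpha ([::], (pos0, [set src])) t).2.2 = [set: 'I_k.+1].

(* None = N, Some None = S, Some (Some (Tagged i j)) = j-th internal node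
   (j = 0 adjacent to N, j = d i - 1 adjacent to S) of the i-th path. *)
Definition theta_vertex (l : nat) (d : 'I_l -> nat) : finType :=
  option (option {i : 'I_l & 'I_(d i)}).

Definition theta_adj0 (l : nat) (d : 'I_l -> nat) (x y : theta_vertex d) : bool :=
  match x, y with
  | None, Some (Some p) => val (tagged p) == 0
  | Some None, Some (Some p) => val (tagged p) == (d (tag p)).-1
  | Some (Some p), Some (Some q) =>
      (tag p == tag q) && (val (tagged q) == (val (tagged p)).+1)
  | _, _ => false
  end.

Definition theta_adj (l : nat) (d : 'I_l -> nat) : rel (theta_vertex d) :=
  fun x y => theta_adj0 x y || theta_adj0 y x.

(* Main.v *)
Require Import Defs.
From mathcomp Require Import all_boot zify.
From Stdlib Require Import ClassicalEpsilon.
Set Implicit Arguments. Unset Strict Implicit. Unset Printing Implicit Defensive.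

(** An admissible graph cuts each path at most once and leaves some path intact.

    Fewer than [l] ignorant agents: the adversary keeps the source "guarded",
    i.e. no other agent lies between it and one of the poles.  It cuts the path
    of the source just ahead of it when that path or the far pole holds an
    ignorant agent, and every other path holding an ignorant agent next to the
    guarding pole.  Distinct cuts are charged to distinct ignorant agents, so
    some path stays intact.

    At least [l] ignorant agents: as long as some agent is ignorant, the agents
    can force an informed and an ignorant agent to meet.  With more than [l]
    agents they can first place one agent inside each path and one on a pole.
    Then agents of the class opposed to the pole agent walk towards it and the
    others walk away from it; an intact path always allows progress, and it ends
    in a meeting or in a path on which an agent of one class is enclosed by two
    of the other, where a single cut cannot prevent a meeting. *)

(** * Coordinates on the theta graph *)

Lemma connect_invariant (T : finType) (e : rel T) (S : T -> Prop) x y :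
  (forall u v, e u v -> S u -> S v) -> connect e x y -> S x -> S y.
Proof.
move=> Se /connectP[s]; elim: s x => [|z s IH] x /=; first by move=> _ ->.
by case/andP=> exz zs ys Sx; apply: (IH z) => //; apply: Se Sx.
Qed.

Section Coordinates.
Variables (l : nat) (d : 'I_l -> nat).
Local Notation V := (theta_vertex d).

Definition pole (b : bool) : V := if b then Some None else None.

Definition inner (i : 'I_l) (v : V) : bool :=
  if v is Some (Some t) then tag t == i else false.

(** [insub q] fails once [q >= d i], so every position past the last internal node denotes [S]. *)
Definition path_vertex (i : 'I_l) (p : nat) : V :=
  if p is q.+1 then
    if (insub q : option 'I_(d i)) is Some j then Some (Some (Tagged (fun i => 'I_(d i)) j))
    else Some None
  else None.
Arguments path_vertex : simpl never.

(* [coord b i p] is the vertex at distance [p] from [pole b] along path [i]: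
   [p = 0] gives [pole b] and [p = (d i).+1] the opposite pole. *)
Definition coord (b : bool) (i : 'I_l) (p : nat) : V :=
  path_vertex i (if b then (d i).+1 - p else p).

(** On internal nodes this is the distance from [pole b] along the path; both poles get 0, even the
    far one. *)
Definition height (b : bool) (v : V) : nat :=
  if v is Some (Some t) then
    if b then d (tag t) - tagged t else (tagged t).+1
  else 0.

Lemma path_vertex_ord i (j : 'I_(d i)) :
  path_vertex i j.+1 = Some (Some (Tagged (fun i => 'I_(d i)) j)).
Proof. by rewrite /path_vertex valK. Qed.

Lemma path_vertex_last i : path_vertex i (d i).+1 = pole true.
Proof. by rewrite /path_vertex insubN ?ltnn. Qed.

Lemma coord0 b i : coord b i 0 = pole b.
Proof. by case: b; rewrite /coord ?subn0 ?path_vertex_last. Qed.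

Lemma coord_flip b i p :
  p <= (d i).+1 -> coord (~~ b) i p = coord b i ((d i).+1 - p).
Proof. by case: b => lep; rewrite /coord ?subKn. Qed.

Lemma coord_last b i : coord b i (d i).+1 = pole (~~ b).
Proof. by rewrite -(coord0 _ i) coord_flip // subn0. Qed.

Lemma coord_innerE b i p : 0 < p <= d i ->
  exists2 j : 'I_(d i), coord b i p = Some (Some (Tagged (fun i => 'I_(d i)) j))
    & p = if b then d i - j else j.+1.
Proof.
case/andP=> p0 pd; have qd : (if b then d i - p else p.-1) < d i by case: b; lia.
exists (Ordinal qd); last by case: b qd => /=; lia.
by rewrite -path_vertex_ord /coord; congr path_vertex => /=; case: b qd; lia.
Qed.

Lemma inner_coord b i i' p : 0 < p <= d i -> inner i' (coord b i p) = (i == i').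
Proof. by case/(coord_innerE b)=> j -> _. Qed.

Lemma height_coord b i p : 0 < p <= d i -> height b (coord b i p) = p.
Proof. by case/(coord_innerE b)=> j -> ->. Qed.

Lemma height_coordN b i p :
  0 < p <= d i -> height (~~ b) (coord b i p) = (d i).+1 - p.
Proof.
move=> pd; have -> : coord b i p = coord (~~ b) i ((d i).+1 - p).
  by rewrite coord_flip ?subKn //; lia.
by rewrite height_coord //; lia.
Qed.

Lemma innerP b i v : inner i v -> exists2 p, 0 < p <= d i & v = coord b i p.
Proof.
case: v => [[[i' j]|]|] //= /eqP<-; have jd := ltn_ord j.
exists (if b then d i' - j else j.+1); first by case: b; lia.
by rewrite -path_vertex_ord /coord; congr path_vertex; case: b; lia.
Qed.

Lemma inner_pole i b : inner i (pole b) = false.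
Proof. by case: b. Qed.

Lemma pole_neq b : pole b <> pole (~~ b).
Proof. by case: b. Qed.

Lemma vertexP b v : [\/ v = pole b, v = pole (~~ b) | exists i, inner i v].
Proof.
case: v => [[[i j]|]|]; first by apply: Or33; exists i => /=.
  by case: b; [apply: Or31 | apply: Or32].
by case: b; [apply: Or32 | apply: Or31].
Qed.

Lemma inner_uniq i i' v : inner i v -> inner i' v -> i = i'.
Proof. by case: v => [[t|]|] //= /eqP-> /eqP->. Qed.

Lemma coord_inj b i i' p q : 0 < p <= d i -> q <= (d i').+1 ->
  coord b i p = coord b i' q -> i = i' /\ p = q.
Proof.
move=> pd qd e; have := inner_coord b i pd; rewrite e eqxx.
case: (posnP q) => [->|q0]; first by rewrite coord0 inner_pole.
move: qd; rewrite leq_eqVlt => /orP[/eqP->|]; first by rewrite coord_last inner_pole.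
rewrite ltnS => qd; have qd' : 0 < q <= d i' by rewrite q0.
rewrite inner_coord // => /eqP ii'; subst i'; split=> //.
by rewrite -(height_coord b pd) e height_coord.
Qed.

Lemma theta_adjC (x y : V) : theta_adj x y = theta_adj y x.
Proof. by rewrite /theta_adj orbC. Qed.

Lemma adj_coord b i p : 0 < d i -> p <= d i -> theta_adj (coord b i p) (coord b i p.+1).
Proof.
move=> d0.
suff H q : q <= d i -> theta_adj (path_vertex i q) (path_vertex i q.+1).
  case: b => pd; rewrite /coord; last exact: H.
  by rewrite theta_adjC subSS subSn //; apply: H; lia.
rewrite /theta_adj leq_eqVlt => /orP[/eqP->|qd].
  have dd : (d i).-1 < d i by lia.
  have -> : path_vertex i (d i) = Some (Some (Tagged _ (Ordinal dd))).
    by rewrite -path_vertex_ord -[in LHS](prednK d0).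
  by rewrite path_vertex_last /= eqxx.
rewrite -[q.+1]/((Ordinal qd).+1) path_vertex_ord.
case: q qd => [|q] qd; first by [].
have qd' : q < d i by lia.
have -> : path_vertex i q.+1 = Some (Some (Tagged _ (Ordinal qd'))).
  by rewrite -path_vertex_ord.
by rewrite /= !eqxx.
Qed.

Lemma adjE b x y : (forall i, 0 < d i) -> theta_adj x y -> exists i p, p <= d i /\
  ((x = coord b i p /\ y = coord b i p.+1) \/ (y = coord b i p /\ x = coord b i p.+1)).
Proof.
move=> d0.
suff H u v : theta_adj0 u v -> exists i p, p <= d i /\
    ((u = coord b i p /\ v = coord b i p.+1) \/ (v = coord b i p /\ u = coord b i p.+1)).
  by case/orP=> /H // [i [p [pd [uv|uv]]]]; exists i, p; split=> //; [right|left].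
suff H : theta_adj0 u v -> exists i p, p <= d i /\
    ((u = path_vertex i p /\ v = path_vertex i p.+1) \/
     (v = path_vertex i p /\ u = path_vertex i p.+1)).
  move=> /H[i [p [pd uv]]]; exists i; case: (b) => /=; last by exists p.
  exists (d i - p); split; first lia.
  rewrite /coord subSS.
  have -> : d i - (d i - p) = p by lia.
  have -> : (d i).+1 - (d i - p) = p.+1 by lia.
  by tauto.
case: u v => [[[i j]|]|] [[[i' j']|]|] //=.
- case/andP=> /eqP ii'; subst i' => /eqP jj'; exists i, j.+1.
  split; first exact: ltn_ord.
  left; rewrite path_vertex_ord; split=> //.
  have -> : j.+2 = (j' : nat).+1 by rewrite -jj'.
  by rewrite path_vertex_ord.
- move/eqP=> jd; exists i', (d i'); split=> //; right; rewrite path_vertex_last.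
  have -> : d i' = j'.+1 by rewrite jd prednK.
  by rewrite path_vertex_ord.
- move/eqP=> j0; exists i', 0; split=> //; left; rewrite -path_vertex_ord j0.
  by [].
Qed.

Hypothesis d_gt0 : forall i, 0 < d i.

Lemma adj_pole b v : theta_adj v (pole b) -> exists i, v = coord b i 1.
Proof.
case/(adjE b d_gt0)=> i [p [pd [[_ e]|[e ->]]]].
  move: pd; rewrite leq_eqVlt => /orP[/eqP pd|pd].
    by move: e; rewrite pd coord_last => /pole_neq.
  by have := @inner_coord b i i p.+1 pd; rewrite -e inner_pole eqxx.
case: p pd e => [|p] pd e; first by exists i.
by have := @inner_coord b i i p.+1 pd; rewrite -e inner_pole eqxx.
Qed.

Lemma adj_inner b i p v : 0 < p <= d i -> theta_adj v (coord b i p) ->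
  v = coord b i p.-1 \/ v = coord b i p.+1.
Proof.
move=> pd /(adjE b d_gt0)[i' [q [qd [[-> e]|[e ->]]]]].
  by have [|<- ->] := coord_inj pd _ e; [lia | left].
by have [|<- ->] := coord_inj pd _ e; [lia | right].
Qed.

(** If both edges were missing, positions [e.+1] to [e'] would be closed under [g] and contain no
    pole, against connectivity. *)
Lemma admissible_one_cut (g : rel V) b i e e' :
  admissible_subgraph (@theta_adj l d) g -> e < e' <= d i ->
  g (coord b i e) (coord b i e.+1) \/ g (coord b i e') (coord b i e'.+1).
Proof.
case=> gadj gC gconn /andP[ee' e'd].
case E: (g _ _); [by left | right]; apply/negPn/negP=> /negbTE E'.
pose S v := exists2 p, e < p <= e' & v = coord b i p.
have: S (pole b).
  apply: (connect_invariant _ (gconn (coord b i e.+1) (pole b))); last first.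
    by exists e.+1 => //; lia.
  move=> u v guv [p pe ue]; have pd : 0 < p <= d i by lia.
  move: (guv); rewrite gC => /gadj; rewrite {1}ue => /(adj_inner pd)[ve|ve].
    exists p.-1 => //; have [pe'|] := boolP (e < p.-1); first lia.
    move=> h; have pe' : p.-1 = e by lia.
    have pe1 : p = e.+1 by lia.
    by move: guv; rewrite ue ve pe' pe1 gC E.
  exists p.+1 => //; have [|] := boolP (p < e'); first lia.
  move=> h; have pe' : p = e' by lia.
  by move: guv; rewrite ue ve pe' E'.
case=> p pe /(congr1 (inner i)); rewrite inner_coord ?inner_pole ?eqxx //; lia.
Qed.

(** If every path were cut, the nodes joined to [pole b] by an uncut initial stretch of a path would
    be closed under [g] and miss the other pole. *)
Lemma admissible_intact_path (g : rel V) b : 0 < l ->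
  admissible_subgraph (@theta_adj l d) g ->
  exists i, forall e, e <= d i -> g (coord b i e) (coord b i e.+1).
Proof.
move=> l0 [gadj gC gconn].
pose Goal := exists i, forall e, e <= d i -> g (coord b i e) (coord b i e.+1).
pose S v := Goal \/ exists i p, [/\ p <= d i, v = coord b i p
  & forall e, e < p -> g (coord b i e) (coord b i e.+1)].
have i0 : 'I_l by exists 0.
have: S (pole (~~ b)).
  apply: (connect_invariant _ (gconn (pole b) (pole (~~ b)))); last first.
    by right; exists i0, 0; rewrite coord0.
  move=> u v guv [|[i [p [pd ue pe]]]]; first by left.
  case: (posnP p) => [p0|p0].
    move: (guv); rewrite gC ue p0 coord0 => /gadj/adj_pole[i' ve].
    right; exists i', 1; split=> //; case=> // _.
    by rewrite -ve coord0 -(coord0 b i) -p0 -ue.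
  have pd' : 0 < p <= d i by rewrite p0.
  move: (guv); rewrite gC => /gadj; rewrite ue => /(adj_inner pd')[ve|ve].
    right; exists i, p.-1; split=> //; first lia.
    by move=> e ep; apply: pe; lia.
  have pe' e : e < p.+1 -> g (coord b i e) (coord b i e.+1).
    by rewrite ltnS leq_eqVlt => /orP[/eqP->|/pe //]; rewrite -ve -ue.
  move: pd; rewrite leq_eqVlt => /orP[/eqP pd|pd].
    by left; exists i => e ed; apply: pe'; rewrite pd ltnS.
  by right; exists i, p.+1.
case=> // [[i [p [pd e _]]]]; case: (posnP p) e => [->|p0].
  by rewrite coord0 => /esym/pole_neq.
move/(congr1 (inner i)); rewrite inner_coord ?inner_pole ?eqxx //; lia.
Qed.

End Coordinates.

Arguments pole {l d} b.
Arguments coord {l d} b i p.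
Arguments coord0 {l d} b i.
Arguments coord_last {l d} b i.
Arguments inner_pole {l d} i b.
Arguments pole_neq {l d} b _.

(** * The adversary's strategy *)

Definition legal_move (V : finType) (n : nat) (g : rel V)
    (p p' : {ffun 'I_n -> V}) : Prop :=
  forall a, p' a = p a \/ g (p a) (p' a).

Section Containment.
Variables (l : nat) (d : 'I_l -> nat).
Hypothesis d_gt1 : forall i, 1 < d i.
Local Notation V := (theta_vertex d).
Local Notation coord := (@coord l d).

Let d_gt0 i : 0 < d i.
Proof. exact: ltnW. Qed.

Lemma coord_eq b i i' p q : p <= (d i).+1 -> q <= (d i').+1 ->
  coord b i p = coord b i' q ->
  [\/ i = i' /\ p = q, p = 0 /\ q = 0 | p = (d i).+1 /\ q = (d i').+1].
Proof.
move=> pd qd e; have [pin|pout] := boolP (0 < p <= d i).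
  by apply: Or31; apply: coord_inj e.
have [qin|qout] := boolP (0 < q <= d i').
  by apply: Or31; have [] := coord_inj qin pd (esym e).
have [p0|p0] := posnP p; have [q0|q0] := posnP q.
- by apply: Or32.
- move: e; have -> : q = (d i').+1 by lia.
  by rewrite p0 coord0 coord_last => /pole_neq.
- move: e; have -> : p = (d i).+1 by lia.
  by rewrite q0 coord0 coord_last => /esym/pole_neq.
- by apply: Or33; lia.
Qed.

Definition cut_graph (b : bool) (c : pred 'I_l) (e : 'I_l -> nat) : rel V :=
  fun x y => theta_adj x y && ~~ [exists i, c i &&
    ((x == coord b i (e i)) && (y == coord b i (e i).+1) ||
     (y == coord b i (e i)) && (x == coord b i (e i).+1))].

Lemma cut_graphC b c e x y : cut_graph b c e x y = cut_graph b c e y x.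
Proof.
rewrite /cut_graph theta_adjC; congr (_ && ~~ _).
by apply: eq_existsb => i; rewrite orbC.
Qed.

Lemma cut_graph_cut b (c : pred 'I_l) e i :
  c i -> cut_graph b c e (coord b i (e i)) (coord b i (e i).+1) = false.
Proof.
move=> ci; rewrite /cut_graph; apply/negbTE/nandP; right; apply/negPn/existsP.
by exists i; rewrite ci !eqxx.
Qed.

Lemma cut_graph_coord b (c : pred 'I_l) e i q : (forall i, e i <= d i) -> q <= d i ->
  (c i -> q <> e i) -> cut_graph b c e (coord b i q) (coord b i q.+1).
Proof.
move=> ed qd qe; rewrite /cut_graph adj_coord //=.
apply/existsP=> -[i' /andP[ci']]; have ed' := ed i'; have d0 := d_gt0 i.
case/orP=> /andP[/eqP E1 /eqP E2].
  (* When the first endpoints agree at [pole b], the paths could differ; the second endpoints then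
     identify them. *)
  have qi : i = i' /\ q = e i'.
    have [||//|[q0 e0]|] := coord_eq _ _ E1; try lia.
    by have [||[ii' _]||] := coord_eq _ _ E2; try lia; split=> //; lia.
  by case: qi => ii' qe'; subst i'; case: (qe ci').
by have [||||] := coord_eq _ _ E1; try lia; have [||||] := coord_eq _ _ E2; lia.
Qed.

(** The uncut path [i0] joins the poles. A node before the cut of its path reaches [pole b]
    directly; one beyond it goes through the far pole. *)
Lemma cut_graph_admissible b (c : pred 'I_l) e i0 : (forall i, e i <= d i) ->
  ~~ c i0 -> admissible_subgraph (@theta_adj l d) (cut_graph b c e).
Proof.
move=> ed ci0; set g := cut_graph b c e.
have gC x y : g x y = g y x by apply: cut_graphC.
have seg i q r : q + r <= (d i).+1 ->
    (forall m, q <= m < q + r -> c i -> m <> e i) ->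
    connect g (coord b i q) (coord b i (q + r)).
  elim: r => [|r IH] qr H; first by rewrite addn0 connect0.
  apply: connect_trans (IH _ _) _; first lia.
    by move=> m mq; apply: H; lia.
  by rewrite addnS; apply/connect1/cut_graph_coord => //; [lia | apply: H; lia].
have gS := sym_connect_sym gC.
have pp : connect g (pole b) (pole (~~ b)).
  rewrite -(coord_last b i0) -(coord0 b i0) -[(d i0).+1]add0n.
  by apply: seg => // m _; rewrite (negbTE ci0).
have toN v : connect g (pole b) v.
  have [->|->|[i]] := vertexP b v; [exact: connect0 | exact: pp | ].
  case/(innerP b)=> q qd ->.
  have [H|H] := boolP (c i && (e i < q)).
    apply: connect_trans pp _; rewrite gS -(coord_last b i).
    have -> : (d i).+1 = q + ((d i).+1 - q) by lia.
    by apply: seg; [lia | move=> m mq _; lia].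
  rewrite -(coord0 b i) -[q]add0n; apply: seg; first lia.
  by move=> m mq ci; rewrite ci /= in H; lia.
split=> // [x y /andP[] //|x y].
by apply: connect_trans (toN y); rewrite gS.
Qed.

(** * Guarded positions of the source *)

Variables (n : nat) (s : 'I_n).

(* The source [s] sits on path [i] and no other agent lies between [s] and
   [pole b], so an attack along path [i] can only come from the other side. *)
Definition guarded (p : {ffun 'I_n -> V}) : Prop :=
  exists b i j, [/\ j <= d i, p s = coord b i j
    & forall a q, a != s -> q <= j -> p a <> coord b i q].

(** If the source stands next to a far pole free of other agents, the viewpoint is reversed: that
    pole guards it at distance [1 < d i]. *)
Lemma guarded_forward (p : {ffun 'I_n -> V}) : guarded p -> exists b i j,
  [/\ j <= d i, p s = coord b i j,
      forall a q, a != s -> q <= j -> p a <> coord b i q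
    & j < d i \/ exists2 a, a != s & p a = pole (~~ b)].
Proof.
case=> b [i [j [jd ps free]]]; have d1 := d_gt1 i.
have [jd'|jd'] := ltnP j (d i); first by exists b, i, j; split=> //; left.
have jE : j = d i by lia.
case: (pickP (fun a => (a != s) && (p a == pole (~~ b)))) => [a /andP[as_ /eqP pa]|no].
  by exists b, i, j; split=> //; right; exists a.
have e1 : coord (~~ b) i 1 = p s.
  by rewrite ps coord_flip ?jE ?subSS ?subn0.
exists (~~ b), i, 1; split; [exact: ltnW | by rewrite e1 | | by left].
move=> a [|[|//]] as_ _.
  by rewrite coord0 => pa; have := no a; rewrite as_ pa eqxx.
by rewrite e1 ps; apply: free.
Qed.

(** Choosing a charged agent for each path would embed the [l] paths into the at most [l - 1] agents
    other than [s]. *)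
Lemma uncut_path (R : 'I_l -> 'I_n -> bool) : n <= l ->
  (forall i a, R i a -> a != s) -> (forall i i' a, R i a -> R i' a -> i = i') ->
  exists i, ~~ [exists a, R i a].
Proof.
move=> nl Rs Runiq; apply/existsP; rewrite -negb_forall; apply/negP=> /forallP H.
have {}H i : exists a, R i a by apply/existsP/H.
have [f Rf] := fin_all_exists H.
have f_inj : injective f by move=> i i' ff; apply: Runiq (Rf i) _; rewrite ff.
have : #|[set f i | i in 'I_l]| <= #|[set~ s]|.
  by apply/subset_leq_card/subsetP=> _ /imsetP[i _ ->]; rewrite !inE (Rs i).
rewrite card_imset // cardsC1 !card_ord; have := ltn_ord s; lia.
Qed.

Lemma guarded_step (p : {ffun 'I_n -> V}) : n <= l -> guarded p ->
  exists g, admissible_subgraph (@theta_adj l d) g /\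
    forall p', legal_move g p p' -> guarded p'.
Proof.
move=> nl /guarded_forward[b [i [j [jd ps free far]]]].
(* [R i' a] charges path [i'] to agent [a]. Agents on the far pole are charged only for the source's
   path [i], so no agent pays twice. *)
pose R i' a := (a != s) && (inner i' (p a) || ((i' == i) && (p a == pole (~~ b)))).
pose c i' := [exists a, R i' a].
pose e i' := if i' == i then j else 0.
have ei : e i = j by rewrite /e eqxx.
pose g := cut_graph b c e.
have gC x y : g x y = g y x by apply: cut_graphC.
have gadj x y : g x y -> theta_adj x y by case/andP.
have cI i' a : a != s -> inner i' (p a) -> c i'.
  by move=> as_ ia; apply/existsP; exists a; rewrite /R as_ ia.
have cP a q : a != s -> 0 < q <= (d i).+1 -> p a = coord b i q -> c i.
  move=> as_ qd pa; apply/existsP; exists a; rewrite /R as_ pa eqxx /=.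
  have [->|qd'] := eqVneq q (d i).+1; first by rewrite coord_last eqxx orbT.
  by rewrite inner_coord ?eqxx //; lia.
have edge i' : c i' -> g (coord b i' (e i')) (coord b i' (e i').+1) = false.
  exact: cut_graph_cut.
have pole_free a : a != s -> p a <> pole b.
  by move=> as_; rewrite -(coord0 b i); apply: free.
exists g; split.
  have [||i0 ci0] := uncut_path (R := R) nl.
  - by move=> i' a /andP[].
  - move=> i1 i2 a /andP[_ /orP[h1|/andP[/eqP-> /eqP pa]]] /andP[_ /orP[h2|/andP[/eqP-> pa2]]] //.
    + exact: inner_uniq h1 h2.
    + by move: h1; rewrite (eqP pa2) inner_pole.
    + by move: h2; rewrite pa inner_pole.
  apply: (@cut_graph_admissible b c e i0) => // i'; rewrite /e.
  by case: eqP => [->|].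
move=> p' mv.
(* An intruder could enter the segment only at [pole b] or at position [j], and its own presence has
   caused the edge it needs to be cut. *)
have free' a q : a != s -> q <= j -> p' a <> coord b i q.
  move=> as_ qj pa; have [st|] := mv a; first by apply: (free a q) => //; rewrite -st.
  rewrite pa => gpa; have := gadj _ _ gpa; have [q0|q0] := posnP q.
    rewrite q0 coord0 => /(adj_pole d_gt0)[i' pa1].
    have ci' : c i' by apply: (cI i' a) => //; rewrite pa1 inner_coord ?eqxx ?d_gt0.
    have ei' : e i' = 0.
      rewrite /e; case: eqP => // ii'; subst i'.
      by case: (posnP j) => // j0; case: (free a 1).
    move: (edge _ ci'); rewrite ei' -pa1 gC.
    by rewrite coord0 -(coord0 b i) -q0 gpa.
  have qd : 0 < q <= d i by lia.
  case/(adj_inner d_gt0 qd)=> pa1; first by case: (free a q.-1) => //; lia.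
  have qj' : q = j.
    by apply/eqP; rewrite eqn_leq qj leqNgt; apply/negP=> qj'; case: (free a q.+1).
  have ci : c i by apply: (cP a q.+1) => //; lia.
  by move: (edge _ ci); rewrite ei -qj' gC -pa1 gpa.
have fwd : ~~ c i -> j < d i.
  move=> nci; case: far => // -[a as_ pa]; case/negP: nci.
  by apply: (cP a (d i).+1) => //; rewrite ?leqnn ?coord_last.
(* An agent found at [j.+1] would come from [j], [j.+1] or [j.+2]; the first is guarded, and the
   others would have caused a cut. *)
have step_fwd : ~~ c i -> p' s = coord b i j.+1 -> guarded p'.
  move=> nci ps'; have jd' := fwd nci; exists b, i, j.+1; split=> // a q as_.
  rewrite leq_eqVlt => /orP[/eqP->|]; last exact: free'.
  move=> pa; case/negP: nci; have [st|] := mv a.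
    by apply: (cP a j.+1) => //; rewrite -?st //; lia.
  rewrite pa => /gadj/(adj_inner d_gt0 (jd' : 0 < j.+1 <= d i))[] pa1; first by case: (free a j).
  by apply: (cP a j.+2).
have [st|gs] := mv s; first by exists b, i, j; split; rewrite ?st.
have nci_of : p' s = coord b i j.+1 -> ~~ c i.
  by move=> ps'; apply/negP=> /edge; rewrite ei -ps' -ps gs.
have [j0|j0] := posnP j.
  have := gs; rewrite gC ps j0 coord0 => /gadj/(adj_pole d_gt0)[i' ps'].
  have [ii'|ii'] := eqVneq i' i.
    by subst i'; apply: step_fwd; [apply: nci_of|]; rewrite ps' j0.
  have nci' : ~~ c i'.
    apply/negP=> /edge; rewrite /e (negbTE ii') -ps' coord0.
    by rewrite -(coord0 b i) -j0 -ps gs.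
  (* The source turns from the pole into an uncut path [i']. Another agent at position 1 would come
     from position 1 or 2, both internal as [1 < d i'], and would have caused a cut. *)
  exists b, i', 1; split; [exact: d_gt0 | exact: ps' |].
  move=> a [|[|//]] as_ _.
    by rewrite coord0 -(coord0 b i); apply: free'.
  move=> pa; case/negP: nci'; apply: (cI i' a) => //; have [<-|] := mv a.
    by rewrite pa inner_coord ?eqxx ?d_gt0.
  rewrite pa => /gadj/(adj_inner d_gt0 (d_gt0 i' : 0 < 1 <= d i'))[] /= pa1.
    by case: (pole_free a) => //; rewrite pa1 coord0.
  by rewrite pa1 inner_coord ?eqxx ?d_gt1.
have jd' : 0 < j <= d i by rewrite j0.
have := gs; rewrite gC ps => /gadj/(adj_inner d_gt0 jd')[] ps'; last first.
  by apply: step_fwd => //; apply: nci_of.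
exists b, i, j.-1; split=> //; first lia.
by move=> a q as_ qj; apply: free' => //; lia.
Qed.

End Containment.

(** A guarded source shares its node with no other agent (the case [q = j]), so preserving [guarded]
    keeps the message with the source forever. *)
Lemma not_solvable_of_few_agents (l : nat) (d : 'I_l -> nat) (k : nat) :
  (forall i, 1 < d i) -> 0 < k < l -> ~ broadcast_solvable (@theta_adj l d) k.
Proof.
move=> d1 /andP[k0 kl] [sigma [sigmaV win]].
have d0 i : 0 < d i by apply: ltnW.
pose V := theta_vertex d; pose s : 'I_k.+1 := ord0.
pose i0 : 'I_l := Ordinal (leq_ltn_trans (leq0n k) kl).
(* The full graph is the answer at unguarded positions, since a valid adversary must answer those
   too. *)
have admT : admissible_subgraph (@theta_adj l d) (@theta_adj l d).
  have [||C1 C2 C3] := @cut_graph_admissible l d d1 false pred0 (fun=> 0) i0 => //.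
  split=> // [x y|x y]; first exact: theta_adjC.
  by apply: connect_sub (C3 x y) => u v /C1; apply: connect1.
have resp (p : {ffun 'I_k.+1 -> V}) : {g | admissible_subgraph (@theta_adj l d) g /\
    (guarded s p -> forall p', legal_move g p p' -> guarded s p')}.
  apply: constructive_indefinite_description.
  have [gp|ngp] := excluded_middle_informative (guarded s p).
    by have [g [ga gg]] := guarded_step d1 kl gp; exists g.
  by exists (@theta_adj l d).
pose alpha : adversary V k.+1 := fun _ c => sval (resp c.1).
pose pos0 : {ffun 'I_k.+1 -> V} := [ffun a => if a == s then pole false
                                 else coord false (widen_ord kl a) 1].
have pos0_inj : injective pos0.
  move=> a a'; rewrite !ffunE; case: eqP => [->|_]; case: eqP => [->|_] //.
  - by move/(congr1 (inner (widen_ord kl a'))); rewrite inner_pole inner_coord ?eqxx ?d0.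
  - by move/(congr1 (inner (widen_ord kl a))); rewrite inner_pole inner_coord ?eqxx ?d0.
  case/coord_inj=> [||/(congr1 val)/= aa' _]; rewrite ?d0 //.
  exact: val_inj.
have [|t] := win pos0 s alpha pos0_inj; first by move=> h c; have [] := svalP (resp c.1).
suff [-> _] : (run sigma alpha ([::], (pos0, [set s])) t).2.2 = [set s] /\
    guarded s (run sigma alpha ([::], (pos0, [set s])) t).2.1.
  by move/(congr1 (fun A : {set _} => #|A|)); rewrite cards1 cardsT card_ord; lia.
elim: t => [|t [IHi IHg]].
  split=> //; exists false, i0, 0; split=> //; first by rewrite ffunE eqxx.
  move=> a [|//] as_ _; rewrite coord0 => pa.
  by case/eqP: as_; apply: pos0_inj; rewrite pa !ffunE.
rewrite /run iterS -/(run _ _ _ t).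
case: (run _ _ _ _) IHi IHg => h [p inf] /= -> gp.
set p' := sigma h _ _.
have gp' : guarded s p'.
  have [ga gg] := svalP (resp p); apply: gg => // a.
  by apply: (sigmaV h (p, [set s])).
split=> //; apply/setP=> a; rewrite !inE; have [//|as_] := eqVneq a s.
apply/existsP=> -[x]; rewrite inE => /andP[/eqP-> /eqP e].
case: gp' => b [i [j [jd ps free]]]; case: (free a j) => //.
by rewrite -ps e.
Qed.

(** * The reachability game *)

Section Game.
Variables (V : finType) (adj : rel V) (n : nat).
Local Notation positions := {ffun 'I_n -> V}.

(** Termination is built in as well-foundedness, without a common bound on the rounds. Taking [next]
    as a function of the graph keeps the recursion direct, hence the induction principle usable. *)
Inductive forces (Q : positions -> Prop) (p : positions) : Prop :=
| forces_now of Q p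
| forces_next (next : rel V -> positions)
    of (forall g, admissible_subgraph adj g -> legal_move g p (next g))
     & (forall g, admissible_subgraph adj g -> forces Q (next g)).

Lemma forces_step Q p :
  (forall g, admissible_subgraph adj g -> exists2 p', legal_move g p p' & forces Q p') ->
  forces Q p.
Proof.
move=> H; have nxt g : {p' | admissible_subgraph adj g -> legal_move g p p' /\ forces Q p'}.
  apply: constructive_indefinite_description.
  have [/H[p' mv fp]|nadm] := excluded_middle_informative (admissible_subgraph adj g).
    by exists p'.
  by exists p.
by apply: (@forces_next _ _ (fun g => sval (nxt g))) => g /(svalP (nxt g))[].
Qed.

Lemma forces_trans (Q R : positions -> Prop) p :
  forces Q p -> (forall p', Q p' -> forces R p') -> forces R p.
Proof.
move=> + QR; elim=> {p} [p /QR //|p next mv _ IH].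
by apply: forces_next mv IH.
Qed.

Definition relocate (p : positions) (a : 'I_n) (v : V) : positions :=
  [ffun c => if c == a then v else p c].

Lemma relocate_same p a v : relocate p a v a = v.
Proof. by rewrite ffunE eqxx. Qed.

Lemma relocate_other p a v c : c != a -> relocate p a v c = p c.
Proof. by rewrite ffunE => /negbTE->. Qed.

Lemma legal_relocate (g : rel V) (p : positions) a v : g (p a) v -> legal_move g p (relocate p a v).
Proof. by move=> gv c; rewrite ffunE; case: eqP => [->|_]; [right | left]. Qed.

Lemma forces_relocate Q (p : positions) :
  (forall g, admissible_subgraph adj g ->
     exists a v, g (p a) v /\ forces Q (relocate p a v)) ->
  forces Q p.
Proof.
move=> H; apply: forces_step => g /H[a [v [gv fp]]].
by exists (relocate p a v) => //; apply: legal_relocate.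
Qed.

Definition meeting (I : {set 'I_n}) (p : positions) : Prop :=
  exists a b, [/\ a \in I, b \notin I & p a = p b].

(** The first disjunct makes [m] an upper bound on the number of rounds. *)
Fixpoint wins_in (m : nat) (c : config V n) : Prop :=
  if m is m'.+1 then
    wins_in m' c \/ forall g, admissible_subgraph adj g ->
      exists2 p', legal_move g c.1 p' & wins_in m' (p', update_informed p' c.2)
  else c.2 = [set: 'I_n].

Definition wins (c : config V n) : Prop := exists m, wins_in m c.

Lemma wins_in_leq m m' c : m <= m' -> wins_in m c -> wins_in m' c.
Proof.
move/subnK<-; elim: (m' - m) => [//|r IH] wc.
by rewrite addSn; left; apply: IH.
Qed.

(* There are finitely many graphs, hence a common bound on the numbers of
   rounds that the agents need against each of them. *)
Lemma wins_step c :
  (forall g, admissible_subgraph adj g ->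
     exists2 p', legal_move g c.1 p' & wins (p', update_informed p' c.2)) ->
  wins c.
Proof.
move=> H.
pose P (G : {set V * V}) m := forall g, admissible_subgraph adj g ->
  (forall x y, g x y = ((x, y) \in G)) ->
  exists2 p', legal_move g c.1 p' & wins_in m (p', update_informed p' c.2).
have exP G : exists m, P G m.
  have [[g [ga gG]]|no] := excluded_middle_informative
      (exists g, admissible_subgraph adj g /\ forall x y, g x y = ((x, y) \in G)).
    have [p' mv [m wm]] := H g ga; exists m => g' _ g'G; exists p' => // a.
    by rewrite g'G -gG; apply: mv.
  by exists 0 => g ga gG; case: no; exists g.
have [f Pf] := fin_all_exists exP.
exists (\max_G f G).+1; right=> g ga; pose G := [set xy | g xy.1 xy.2].
have [|p' mv wp] := Pf G g ga; first by move=> x y; rewrite inE.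
by exists p' => //; apply: wins_in_leq wp; apply: leq_bigmax.
Qed.

(** Induction on the number of ignorant agents. During a phase [I] is frozen and the forced meeting
    pursued; any growth of [I], planned or accidental, starts the next phase. *)
Lemma wins_of_meeting (src : 'I_n) :
  (forall (I : {set 'I_n}) p, src \in I -> I != setT -> forces (meeting I) p) ->
  forall p, wins (p, [set src]).
Proof.
move=> H p; have [N] := ubnPleq #|~: [set src]|; move: (set11 src).
elim: N p [set src] => [|N IH] p I sI.
  by rewrite leqn0 cards_eq0 => /eqP/(congr1 (@setC _)); rewrite setCK setC0; exists 0.
move=> cI; have [IT|IT] := eqVneq I setT; first by exists 0.
have grow p' : update_informed p' I != I -> wins (p', update_informed p' I).
  move=> ne; apply: IH; first by rewrite inE sI.
  rewrite -ltnS (leq_trans _ cI) // proper_card // properC properEneq eq_sym ne.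
  exact: subsetUl.
elim: (H I p sI IT) => {p} [p|p next mv _ IHp].
  (* A meeting already present informs a new agent after a round in which all stay. *)
  case=> a [b [aI bI ab]]; apply: wins_step => g _; exists p; first by left.
  apply: grow; apply: contraNneq bI => <-; rewrite !inE; apply/orP; right.
  by apply/existsP; exists a; rewrite aI ab /=.
apply: wins_step => g ga; exists (next g); first exact: mv.
have [->|] := eqVneq (update_informed (next g) I) I; first exact: IHp.
exact: grow.
Qed.

End Game.

(** A response attaining the least bound serves every larger one, so one choice per configuration
    and graph gives a strategy that consults neither the history nor the number of rounds left. *)
Lemma solvable_of_wins (V : finType) (adj : rel V) k :
  (forall p (src : 'I_k.+1), wins adj (p, [set src])) -> broadcast_solvable adj k.
Proof.
move=> H.
pose good (c : config V k.+1) (g : rel V) p' m :=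
  legal_move g c.1 p' /\ wins_in adj m (p', update_informed p' c.2).
have best c g : {p' | legal_move g c.1 p' /\
    forall m, (exists p'', good c g p'' m) -> good c g p' m}.
  apply: constructive_indefinite_description.
  have [[m0 ex0]|no] := excluded_middle_informative (exists m p', good c g p' m).
    pose P m : bool := excluded_middle_informative (exists p', good c g p' m).
    have exP : exists m, P m by exists m0; rewrite /P; case: excluded_middle_informative.
    case: (ex_minnP exP) => m; rewrite /P.
    case: excluded_middle_informative => // -[p' [mv wp]] _ minm; exists p'.
    split=> // m' ex'; split=> //; apply: wins_in_leq wp; apply: minm.
    by case: excluded_middle_informative.
  exists c.1; split; first by left.
  by move=> m [p' gp]; case: no; exists m, p'.
pose sigma : strategy V k.+1 := fun _ c g => sval (best c g).
exists sigma; split=> [h c g _|pos0 src alpha _ alphaV].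
  by have [] := svalP (best c g).
have [m] := H pos0 src; move: [::] (pos0, _).
elim: m => [|m IH] h c /=; first by exists 0.
case=> [|wc]; first exact: IH.
have [p' mv wp] := wc _ (alphaV h c).
have [mv' /(_ m)[]] := svalP (best c (alpha h c)); first by exists p'.
move=> _ wb; have [t Et] := IH (rcons h (c, alpha h c)) _ wb.
by exists t.+1; rewrite /run iterSr.
Qed.

(** * The agents' strategy *)

Lemma ltn_sum_at (T : finType) (F G : T -> nat) i :
  (forall j, j != i -> F j = G j) -> F i < G i -> \sum_j F j < \sum_j G j.
Proof.
by move=> FG lt; rewrite !(bigD1 (P := xpredT) i) //= (eq_bigr G) // ltn_add2r.
Qed.

Section Pursuit.
Variables (l : nat) (d : 'I_l -> nat) (n : nat).
Hypotheses (l_gt0 : 0 < l) (d_gt0 : forall i, 0 < d i).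
Local Notation V := (theta_vertex d).
Local Notation coord := (@coord l d).
Local Notation positions := {ffun 'I_n -> V}.
Local Notation admissible := (admissible_subgraph (@theta_adj l d)).
Local Notation forces := (@forces V (@theta_adj l d) n).

(** * Capture with a representative on every path *)

Section Capture.
Variable I : {set 'I_n}.
Local Notation opposed a b := ((a \in I) != (b \in I)).

Lemma meeting_opposed (p : positions) a b : opposed a b -> p a = p b -> meeting I p.
Proof.
by case: (boolP (a \in I)); case: (boolP (b \in I)) => // bI aI _ ab;
  [exists a, b | exists b, a].
Qed.

(* Lexicographic descent: either [w] can approach [x], or path [i] is cut in
   front of [w] and then [y] can approach [w]. *)
Lemma forces_sandwich b i x w y q r (p : positions) :
  opposed x w -> opposed y w -> x != y ->
  p x = pole b -> p w = coord b i q -> p y = coord b i (q + r) -> q + r <= (d i).+1 ->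
  forces (meeting I) p.
Proof.
move=> xw yw xy; have wx : w != x by apply: contraNneq xw => ->.
have wy : w != y by apply: contraNneq yw => ->.
elim: q r p => [|q IHq] r p px.
  rewrite coord0 => pw _ _; apply: forces_now; apply: meeting_opposed xw _.
  by rewrite px pw.
elim: r p px => [|r IHr] p px pw py qr.
  apply: forces_now; apply: meeting_opposed yw _; by rewrite py pw addn0.
apply: forces_relocate => g ga; have [_ gC _] := ga.
have [|gq|gr] := @admissible_one_cut _ _ d_gt0 g b i q (q.+1 + r) ga; first lia.
  exists w, (coord b i q); rewrite pw gC gq; split=> //.
  apply: (IHq r.+2); rewrite ?relocate_same ?relocate_other 1?eq_sym //; last lia.
  by rewrite py addSnnS.
exists y, (coord b i (q.+1 + r)); rewrite py addnS gC gr; split=> //.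
by apply: IHr; rewrite ?relocate_same ?relocate_other //; lia.
Qed.

(* Agents of the class opposed to [y] head for [y], the others for the opposite
   pole, where they complete a sandwich. *)
Lemma forces_surrounded b y w (rep : 'I_l -> 'I_n) (h : 'I_l -> nat) (p : positions) :
  injective rep -> (forall i, rep i != y) -> opposed y w -> p y = pole b ->
  (forall i, h i <= (d i).+1) -> (forall i, p (rep i) = coord b i (h i)) ->
  (exists i, w = rep i) \/ p w = pole (~~ b) ->
  forces (meeting I) p.
Proof.
move=> rep_inj repy yw; have wy : w != y by apply: contraNneq yw => ->.
(* [m h i] is the distance from the representative of path [i] to its destination. *)
pose m (h : 'I_l -> nat) i := if opposed y (rep i) then h i else (d i).+1 - h i.
have [N] := ubnP (\sum_i m h i); elim: N => // N IH in h p *.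
move=> mN py hd ph wP.
have [/existsP[i /andP[op /eqP h0]]|no0] := boolP [exists i, opposed y (rep i) && (h i == 0)].
  by apply: forces_now; apply: meeting_opposed op _; rewrite py ph h0 coord0.
(* A representative in the class of [y] has reached the far pole: either [w] is enclosed between it
   and [y], or [w] is already there. *)
have [/existsP[i /andP[op /eqP hi]]|no1] :=
    boolP [exists i, ~~ opposed y (rep i) && (h i == (d i).+1)].
  have opw : opposed (rep i) w by rewrite -(eqP (negPn op)).
  have pi : p (rep i) = pole (~~ b) by rewrite ph hi coord_last.
  case: wP => [[j wj]|pw].
    apply: (@forces_sandwich b j y w (rep i) (h j) ((d j).+1 - h j)) => //.
    - by rewrite eq_sym.
    - by rewrite wj.
    - by rewrite subnKC // coord_last.
    - by rewrite subnKC.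
  by apply: forces_now; apply: meeting_opposed opw _; rewrite pi pw.
apply: forces_relocate => g ga; have [_ gC _] := ga.
have [i gi] := admissible_intact_path d_gt0 b l_gt0 ga.
pose move_to q := [eta h with i |-> q].
have next q : q <= (d i).+1 -> m (move_to q) i < m h i ->
    forces (meeting I) (relocate p (rep i) (coord b i q)).
  move=> qd mq; apply: (IH (move_to q)).
  - rewrite -ltnS; apply: leq_trans mN; rewrite ltnS; apply: ltn_sum_at mq => i' ii'.
    by rewrite /m /move_to /= (negbTE ii').
  - by rewrite relocate_other // eq_sym.
  - by move=> i'; rewrite /move_to /=; case: eqP => [->|].
  - move=> i'; rewrite /move_to /=; case: eqP => [->|/eqP ii'].
      by rewrite relocate_same.
    by rewrite relocate_other ?ph // (inj_eq rep_inj).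
  - case: wP => [|pw]; first by left.
    have [wi|wi] := eqVneq w (rep i); first by left; exists i.
    by right; rewrite relocate_other.
have hdi := hd i; have [op|nop] := boolP (opposed y (rep i)).
  have h0 : 0 < h i.
    by rewrite lt0n; apply: contra no0 => h0; apply/existsP; exists i; rewrite op.
  exists (rep i), (coord b i (h i).-1); rewrite ph; split.
    by rewrite gC -{2}(prednK h0) gi //; lia.
  by apply: next; [lia | rewrite /m op /move_to /= eqxx; lia].
have h1 : h i <= d i.
  rewrite leqNgt; apply: contra no1 => h1; apply/existsP; exists i; rewrite nop /=.
  by apply/eqP; lia.
exists (rep i), (coord b i (h i).+1); rewrite ph; split; first exact: gi.
by apply: next => //; rewrite /m (negbTE nop) /move_to /= eqxx; lia.
Qed.
End Capture.

(** * Spreading the agents over all paths *)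

Definition occupied (p : positions) : {set 'I_l} :=
  [set i | [exists a, inner i (p a)]].

Definition travellers (p : positions) : {set 'I_n} :=
  [set a | [exists i, inner i (p a)]].

Lemma occupiedP (p : positions) a i : inner i (p a) -> i \in occupied p.
Proof. by move=> ia; rewrite inE; apply/existsP; exists a. Qed.

Lemma occupied_relocate (p : positions) a v :
  (forall i, inner i (p a) -> inner i v \/ exists2 c, c != a & inner i (p c)) ->
  occupied p \subset occupied (relocate p a v).
Proof.
move=> H; apply/subsetP=> i; rewrite inE => /existsP[c ic].
have [ca|ca] := eqVneq c a.
  have [|iv|[c' ca' ic']] := H i; first by rewrite -ca.
    by apply: (@occupiedP _ a); rewrite relocate_same.
  by apply: (@occupiedP _ c'); rewrite relocate_other.
by apply: (@occupiedP _ c); rewrite relocate_other.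
Qed.

Lemma travellers_relocate (p : positions) a v :
  a \in travellers p -> travellers (relocate p a v) \subset travellers p.
Proof.
move=> ta; apply/subsetP=> c; have [->//|ca] := eqVneq c a.
by rewrite !inE relocate_other.
Qed.

Lemma travellers_exit (p : positions) a b :
  a \in travellers p -> #|travellers (relocate p a (pole b))| < #|travellers p|.
Proof.
move=> ta; apply/proper_card/properP; split; first exact: travellers_relocate.
exists a => //; rewrite inE relocate_same; apply/existsP=> -[i].
by rewrite inner_pole.
Qed.

Lemma occupied_fill (p : positions) a b c f q : p a = pole b -> f \notin occupied p ->
  0 < q <= d f -> #|occupied p| < #|occupied (relocate p a (coord c f q))|.
Proof.
move=> pa fo qd; apply/proper_card/properP; split.
  by apply: occupied_relocate => i; rewrite pa inner_pole.
by exists f => //; apply: (@occupiedP _ a); rewrite relocate_same inner_coord ?eqxx.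
Qed.

Definition spreads (m : nat) (p : positions) : Prop := m < #|occupied p|.

Lemma exists_free_path m p : m < l -> #|occupied p| <= m -> exists f, f \notin occupied p.
Proof.
move=> ml om; apply/existsP; rewrite -negb_forall; apply/negP=> /forallP H.
have : occupied p = setT by apply/setP=> i; rewrite H inE.
by move/(congr1 (fun A : {set _} => #|A|)); rewrite cardsT card_ord; lia.
Qed.

(** The two end edges of a free path cannot both be cut, so [a] or [a'] can enter it. *)
Lemma forces_spread_both m b a a' (p : positions) : m < l -> m <= #|occupied p| ->
  p a = pole b -> p a' = pole (~~ b) -> forces (spreads m) p.
Proof.
move=> ml mo pa pa'; have [lt|ge] := ltnP m #|occupied p|; first exact: forces_now.
have [f fo] := exists_free_path ml ge; apply: forces_relocate => g ga.
have [_ gC _] := ga.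
have [|g0|gd] := @admissible_one_cut _ _ d_gt0 g b f 0 (d f) ga.
- by rewrite d_gt0 leqnn.
- exists a, (coord b f 1); rewrite pa -(coord0 b f) g0; split=> //.
  apply: forces_now; apply: leq_ltn_trans mo _.
  by apply: occupied_fill pa fo _; rewrite d_gt0.
exists a', (coord b f (d f)); rewrite pa' -(coord_last b f) gC gd; split=> //.
apply: forces_now; apply: leq_ltn_trans mo _.
by apply: occupied_fill pa' fo _; rewrite d_gt0 leqnn.
Qed.

(* A resident of an intact path advances to [pole (~~ b)]; when it leaves its
   path, [a] enters the path behind it, so that both poles are occupied. *)
Lemma forces_spread_same m b a a' (p : positions) : m < l -> m <= #|occupied p| ->
  a != a' -> p a = pole b -> p a' = pole b -> forces (spreads m) p.
Proof.
(* The potential sums the distances of the internal agents to the far pole; it drops whenever a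
   resident advances inside its path. *)
move=> ml mo aa'; have [N] := ubnP (\sum_c height (~~ b) (p c)).
elim: N => // N IH in p mo *; move=> sN pa pa'.
have [lt|ge] := ltnP m #|occupied p|; first exact: forces_now.
have [f fo] := exists_free_path ml ge; apply: forces_step => g ga.
have [_ gC _] := ga; have [i gi] := admissible_intact_path d_gt0 b l_gt0 ga.
have [|io] := boolP (i \in occupied p); last first.
  exists (relocate p a (coord b i 1)).
    by apply: legal_relocate; rewrite pa -(coord0 b i) gi.
  apply: forces_now; apply: leq_ltn_trans mo _.
  by apply: occupied_fill pa io _; rewrite d_gt0.
rewrite inE => /existsP[r ir]; have [q qd pr] := innerP b ir.
have ra : r != a by apply: contraTneq ir => ->; rewrite pa inner_pole.
have ra' : r != a' by apply: contraTneq ir => ->; rewrite pa' inner_pole.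
have [qlt|qge] := ltnP q (d i).
  have q1d : 0 < q.+1 <= d i by lia.
  exists (relocate p r (coord b i q.+1)).
    by apply: legal_relocate; rewrite pr gi //; lia.
  apply: IH; rewrite ?relocate_other 1?eq_sym //.
    apply: leq_trans mo (subset_leq_card _); apply: occupied_relocate => i' ir'.
    by left; rewrite inner_coord //; apply/eqP; apply: inner_uniq ir ir'.
  rewrite -ltnS; apply: leq_trans sN; rewrite ltnS; apply: (@ltn_sum_at _ _ _ r).
    by move=> c cr; rewrite relocate_other.
  by rewrite relocate_same pr !height_coordN //; lia.
have qE : q = d i by lia.
pose p1 := relocate p r (pole (~~ b)); pose p2 := relocate p1 a (coord b i 1).
exists p2.
  move=> c; rewrite /p2 /p1 /relocate !ffunE; case: eqP => [->|_].
    by right; rewrite pa -(coord0 b i) gi.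
  by case: eqP => [->|_]; [right; rewrite pr qE -(coord_last b i) gi | left].
apply: (@forces_spread_both m b a' r) => //.
- apply: leq_trans mo (subset_leq_card _); apply/subsetP=> i'.
  rewrite inE => /existsP[c ic]; have [cr|cr] := eqVneq c r.
    apply: (@occupiedP _ a); rewrite relocate_same inner_coord ?d_gt0 //.
    by apply/eqP; apply: inner_uniq ir _; rewrite -cr.
  have ca : c != a by apply: contraTneq ic => ->; rewrite pa inner_pole.
  by apply: (@occupiedP _ c); rewrite /p2 /p1 !relocate_other.
- by rewrite /p2 /p1 !relocate_other // eq_sym.
- by rewrite /p2 /p1 relocate_other // relocate_same.
Qed.

(* Path [i] is not cut both below [x] and above [y], so one of them moves on. *)
Lemma forces_exit_ordered i x y q r (A : {set 'I_l}) m (p : positions) :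
  x != y -> p x = coord false i q -> p y = coord false i r -> 0 < q <= r -> r <= d i ->
  A \subset occupied p -> #|travellers p| <= m ->
  forces (fun p' => A \subset occupied p' /\ #|travellers p'| < m) p.
Proof.
(* The distances of [x] to [N] and of [y] to [S] add up to a decreasing measure; [A] and [m] stay
   fixed while [p] varies. *)
move=> xy; have [N] := ubnP (q + ((d i).+1 - r)).
elim: N => // N IH in p q r *; move=> qrN px py qr rd Ao tm.
have qd : 0 < q <= d i by lia.
have rd' : 0 < r <= d i by lia.
have ix : inner i (p x) by rewrite px inner_coord ?eqxx.
have iy : inner i (p y) by rewrite py inner_coord ?eqxx.
have tx : x \in travellers p by rewrite inE; apply/existsP; exists i.
have ty : y \in travellers p by rewrite inE; apply/existsP; exists i.
have keep c c' v : c != c' -> inner i (p c) -> inner i (p c') ->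
    A \subset occupied (relocate p c v).
  move=> cc' ic ic'; apply: subset_trans Ao _; apply: occupied_relocate => i' ic2.
  by right; exists c'; rewrite 1?eq_sym // -(inner_uniq ic ic2).
have yx : y != x by rewrite eq_sym.
apply: forces_relocate => g ga; have [_ gC _] := ga.
have [|gq|gr] := @admissible_one_cut _ _ d_gt0 g false i q.-1 r ga; first lia.
  exists x, (coord false i q.-1); rewrite px gC -{2}(prednK (proj1 (andP qd))) gq.
  split=> //; have [q0|q0] := posnP q.-1.
    apply: forces_now; split; first exact: keep xy ix iy.
    by rewrite q0 coord0; apply: leq_trans (travellers_exit _ tx) tm.
  apply: (IH _ q.-1 r); rewrite ?relocate_same ?relocate_other //; try lia.
    exact: keep xy ix iy.
  exact: leq_trans (subset_leq_card (travellers_relocate _ tx)) tm.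
exists y, (coord false i r.+1); rewrite py gr; split=> //.
have [rlt|rge] := ltnP r (d i).
  apply: (IH _ q r.+1); rewrite ?relocate_same ?relocate_other //; try lia.
    exact: keep yx iy ix.
  exact: leq_trans (subset_leq_card (travellers_relocate _ ty)) tm.
apply: forces_now; split; first exact: keep yx iy ix.
have -> : r = d i by lia.
by rewrite coord_last; apply: leq_trans (travellers_exit _ ty) tm.
Qed.

Lemma forces_exit i x y (p : positions) : x != y -> inner i (p x) -> inner i (p y) ->
  forces (fun p' => occupied p \subset occupied p' /\ #|travellers p'| < #|travellers p|) p.
Proof.
move=> xy /(innerP false)[q qd px] /(innerP false)[r rd py].
have [qr|rq] := leqP q r.
  by apply: (@forces_exit_ordered i x y q r) => //; lia.
by apply: (@forces_exit_ordered i y x r q) => //; rewrite 1?eq_sym //; lia.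
Qed.

(** Sending a traveller to its path is injective here; [f] takes its default only at agents on
    poles. *)
Lemma travellers_le_occupied (p : positions) :
  (forall i x y, inner i (p x) -> inner i (p y) -> x = y) ->
  #|travellers p| <= #|occupied p|.
Proof.
move=> uniq_in; pose f a := odflt (Ordinal l_gt0) [pick i | inner i (p a)].
have fP a : a \in travellers p -> inner (f a) (p a).
  by rewrite inE /f => /existsP[i ia]; case: pickP => [//|/(_ i)]; rewrite ia.
rewrite -(card_in_imset (f := f)).
  by apply/subset_leq_card/subsetP=> _ /imsetP[a /fP ia ->]; apply: occupiedP ia.
by move=> x y /fP ix /fP iy fxy; apply: uniq_in ix _; rewrite fxy.
Qed.

Lemma not_traveller b (p : positions) a :
  a \notin travellers p -> p a = pole b \/ p a = pole (~~ b).
Proof.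
have [->|->|[i ia]] := vertexP b (p a); [by left | by right | ].
by rewrite inE => /existsP[]; exists i.
Qed.

(** Outer induction on the number of free paths, inner on the number of travellers: a path with two
    residents expels one; otherwise agents on poles fill a free path. *)
Lemma forces_full (p : positions) : l < n ->
  forces (fun p' => occupied p' = setT /\ #|travellers p'| < n) p.
Proof.
move=> ln; have [N] := ubnP (l - #|occupied p|); elim: N => // N IHN in p *.
have [M] := ubnP #|travellers p|; elim: M => // M IHM in p *; move=> tM oN.
have ol : #|occupied p| <= l by rewrite -[l in _ <= l]card_ord max_card.
have [/existsP[i /existsP[x /existsP[y /and3P[xy ix iy]]]]|no2] :=
    boolP [exists i, exists x, exists y, [&& x != y, inner i (p x) & inner i (p y)]].
  apply: forces_trans (forces_exit xy ix iy) _ => p' [/subset_leq_card oo tt].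
  by apply: IHM; lia.
have to : #|travellers p| <= #|occupied p|.
  apply: travellers_le_occupied => i x y ix iy; apply/eqP; apply: contraNT no2 => xy.
  apply/existsP; exists i; apply/existsP; exists x; apply/existsP; exists y.
  by rewrite xy ix iy.
have [oT|oT] := eqVneq (occupied p) setT.
  by apply: forces_now; split=> //; lia.
have olt : #|occupied p| < l.
  rewrite -[l in _ < l]card_ord -cardsT proper_card // properEneq oT subsetT //.
(* Fewer than [l] agents travel and [l < n], so at least two stand on poles. *)
have : 1 < #|~: travellers p|.
  by have := cardsC (travellers p); rewrite card_ord; lia.
case/card_gt1P=> a [a' [ta ta' aa']]; rewrite !inE in ta ta'.
suff: forces (spreads #|occupied p|) p.
  move/forces_trans; apply=> p'; rewrite /spreads => oo.
  have ol' : #|occupied p'| <= l by rewrite -[l in _ <= l]card_ord max_card.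
  by apply: IHN; lia.
have [b pa] : exists b, p a = pole b.
  by case: (@not_traveller false p a) => [|->|->]; rewrite ?inE //;
    [exists false | exists true].
case: (@not_traveller b p a') => [|pa'|pa']; first by rewrite inE.
  exact: forces_spread_same aa' pa pa'.
exact: forces_spread_both pa pa'.
Qed.

(** With every path inhabited and some agent [y] left on a pole, any [w] of the other class allows
    the capture. *)
Lemma forces_meeting (I : {set 'I_n}) (p : positions) (s : 'I_n) :
  l < n -> s \in I -> I != setT -> forces (meeting I) p.
Proof.
move=> ln sI IT; apply: forces_trans (forces_full p ln) _ => {}p [oT tn].
have [y ty] : exists y, y \notin travellers p.
  apply/existsP; rewrite -negb_forall; apply/negP=> /forallP H.
  have : travellers p = setT by apply/setP=> a; rewrite H inE.
  by move/(congr1 (fun A : {set _} => #|A|)); rewrite cardsT card_ord; lia.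
have [b py] : exists b, p y = pole b.
  by case: (@not_traveller false p y) => [//|->|->]; [exists false | exists true].
have [w yw] : exists w, (y \in I) != (w \in I).
  have [yI|yI] := boolP (y \in I); last by exists s; rewrite sI.
  have [w wI] : exists w, w \notin I.
    apply/existsP; rewrite -negb_forall; apply: contra IT => /forallP H.
    by apply/eqP/setP=> a; rewrite H inE.
  by exists w; rewrite (negbTE wI).
(* If [w] is internal, it must itself represent its path, as [forces_surrounded] requires. *)
have rep_ex i : exists a, inner i (p a) /\ (inner i (p w) -> a = w).
  have [iw|niw] := boolP (inner i (p w)); first by exists w.
  have : i \in occupied p by rewrite oT inE.
  by rewrite inE => /existsP[a ia]; exists a.
have [rep repP] := fin_all_exists rep_ex.
have h_ex i : exists q, q <= (d i).+1 /\ p (rep i) = coord b i q.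
  have [/(innerP b)[q qd ->] _] := repP i; by exists q; split=> //; lia.
have [h hP] := fin_all_exists h_ex.
have [pw|npw] := eqVneq (p w) (pole b).
  by apply: forces_now; apply: meeting_opposed yw _; rewrite py pw.
apply: (@forces_surrounded I b y w rep h) => //.
- move=> i j ij; have [ii _] := repP i; apply: inner_uniq ii _.
  by rewrite ij; case: (repP j).
- by move=> i; have [ii _] := repP i; apply: contraTneq ii => ->; rewrite py inner_pole.
- by move=> i; case: (hP i).
- by move=> i; case: (hP i).
have [pw|->|[i iw]] := vertexP b (p w); [by rewrite pw eqxx in npw | by right |].
by left; exists i; have [_ ->] := repP i.
Qed.

End Pursuit.

Theorem theorem2 (l : nat) (d : 'I_l -> nat) (k : nat) :
  1 <= l -> (forall i, 3 <= d i) -> 1 <= k ->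
  (broadcast_solvable (@theta_adj l d) k <-> l <= k).
Proof.
move=> l0 d3 k0; split=> [solv|lk].
  rewrite leqNgt; apply/negP=> kl.
  by apply: not_solvable_of_few_agents solv => [i|]; [exact: ltnW | rewrite k0].
apply: solvable_of_wins => p src; apply: wins_of_meeting => I q srcI IT.
by apply: forces_meeting srcI IT => // i; apply: leq_trans (d3 i).
Qed.
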